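(* Let $P$ be a (positive) random field on $\mathbb{Z}^d$ with finite state space $X$ whose system $G(P,\mathcal{F})=\{g_V^{\bar x},\ \bar x\in\mathcal{X}_V(\mathcal{F}),\ V\in W\}$ of conditional distributions with respect to some filtration $\mathcal{F}$ is positive, i.e. $g_V^{\bar x}(x)>0$ for all $V\in W$, $\bar x\in\mathcal{X}_V(\mathcal{F})$, $x\in X^V$. Then the elements of $G(P,\mathcal{F})$ necessarily have the Gibbs form $$g_V^{\bar x}(x)=\frac{\exp\{\Delta_V^{\bar x}(x,u)\}}{\sum_{\alpha\in X^V}\exp\{\Delta_V^{\bar x}(\alpha,u)\}},\qquad x\in X^V,\ \bar x\in\mathcal{X}_V(\mathcal{F}),\ V\in W,$$ where $u\in X^V$ and $\boldsymbol{\Delta}(P,\mathcal{F})=\{\Delta_V^{\bar x},\ \bar x\in\mathcal{X}_V(\mathcal{F}),\ V\in W\}$ is the system of transition energies of $P$ with respect to $\mathcal{F}$.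
   Context: Notation. $X$ is a finite set, $1<|X|<\infty$; $d\ge 1$; $W$ is the set of nonempty finite subsets of $\mathbb{Z}^d$. For $S\subset\mathbb{Z}^d$, $S^c$ is its complement, $X^S$ is the set of all functions (configurations) $S\to X$, and $x_T$ is the restriction of $x\in X^S$ to $T\subset S$; $X^{\emptyset}$ consists of the empty configuration. For disjoint $S,T$ and $x\in X^S$, $y\in X^T$, $xy\in X^{S\cup T}$ is the concatenation. $X^S$ carries the product $\sigma$-algebra $\mathcal{B}^S$ (of the discrete ones). A random field is a probability measure $P$ on $(X^{\mathbb{Z}^d},\mathcal{B}^{\mathbb{Z}^d})$; $P_S$ is its marginal on $X^S$, with $P_{\emptyset}=1$ on the empty configuration. It is positive if $P_V(x)>0$ for all $V\in W$, $x\in X^V$. All random fields considered are positive. A filtration means a sequence $\mathcal{F}=\{\mathcal{B}^{\Lambda_n}\}_{n\ge1}$, where $\Lambda_n\in W$, $\Lambda_n\subset\Lambda_{n+1}$, $\bigcup_n\Lambda_n=\mathbb{Z}^d$. Finite-conditional distributions of $P$: $g_V^z(x)=P_{V\cup\Lambda}(xz)/P_\Lambda(z)$, $x\in X^V$, $z\in X^\Lambda$, for $V\in W$ and finite $\Lambda\subset V^c$. For $V\in W$, $\mathcal{X}_V(\mathcal{F})$ is the set of all $\bar x\in X^{V^c}$ for which the limits $g_V^{\bar x}(x)=\lim_{n\to\infty}g_V^{\bar x_{\Lambda_n\setminus V}}(x)$ exist for all $x\in X^V$. When $G(P,\mathcal{F})$ is positive, the system of transition energies of $P$ with respect to $\mathcal{F}$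 consists of the functions $$\Delta_V^{\bar x}(x,u)=\ln\frac{g_V^{\bar x}(x)}{g_V^{\bar x}(u)},\qquad x,u\in X^V,\ \bar x\in\mathcal{X}_V(\mathcal{F}),\ V\in W.$$ *)

(* Defs.v *)
From HB Require Import structures.
From mathcomp Require Import all_boot all_order all_algebra.
From mathcomp Require Import finmap.
From mathcomp Require Import all_classical all_reals all_analysis.
Import Order.TTheory GRing.Theory Num.Theory.
Import numFieldNormedType.Exports.

Set Implicit Arguments.
Unset Strict Implicit.
Unset Printing Implicit Defensive.

Local Open Scope classical_set_scope.
Local Open Scope ring_scope.

Notation lattice d := 'rV[int]_d.

(* The proof hX is a parameter because measurable types are pointed, so the
   configuration space needs an inhabitant. *)
Definition config (d : nat) (X : finType) (hX : (1 < #|X|)%N) : Type :=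
  lattice d -> X.

HB.instance Definition _ d X hX :=
  Choice.copy (@config d X hX) (lattice d -> X).
HB.instance Definition _ d X hX :=
  isPointed.Build (@config d X hX) (fun=> enum_val (Ordinal (ltnW hX))).

Definition coordinate_events d (X : finType) (hX : (1 < #|X|)%N) :
    set (set (config d hX)) :=
  \bigcup_(t in [set: lattice d])
    preimage_set_system setT (fun w : config d hX => w t) [set: set X].

(* The product of the discrete sigma-algebras is the one generated by the
   coordinate events. *)
Definition random_field (R : realType) d (X : finType) (hX : (1 < #|X|)%N) :=
  probability (g_sigma_algebraType (@coordinate_events d X hX)) R.

(* A filtration is the sequence of the sigma-algebras on X^(Lambda_n); it is
   given by its windows Lambda_n, which determine it.  Here [window F n] is
   Lambda_(n+1), the numbering of the windows starting from 1. *)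
Record filtration (d : nat) := Filtration {
  window :> nat -> {fset lattice d};
  window_neq0 : forall n, window n != fset0;
  window_subset : forall n, (window n `<=` window n.+1)%fset;
  window_exhaust : forall t, exists n, t \in window n }.

(* X^S for a finite set S of sites, and X^(V^c). *)
Notation fin_config X S := {ffun S -> X}.
Notation outer_config X V := ({t | t \notin V} -> X).

Section RandomField.
Context {R : realType} {d : nat} {X : finType} {hX : (1 < #|X|)%N}.
Implicit Types (P : random_field R d hX) (F : filtration d).
Implicit Types (V S L : {fset lattice d}).

Definition marginal P S (x : fin_config X S) : R :=
  fine (P [set w : config d hX | forall s : S, w (val s) = x s]).

Definition positive_field P : Prop :=
  forall V, V != fset0 -> forall x : fin_config X V, 0 < marginal P x.

Lemma in_concat_right V L (t : (V `|` L)%fset) :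
  val t \notin V -> val t \in L.
Proof. by move=> tV; have := valP t; rewrite in_fsetU (negbTE tV). Qed.

(* The concatenation xz; it is only meant for disjoint V and L. *)
Definition concat V L (x : fin_config X V) (z : fin_config X L) :
    fin_config X (V `|` L)%fset :=
  [ffun t => match boolP (val t \in V) with
             | AltTrue tV => x [` tV]%fset
             | AltFalse tV => z [` in_concat_right tV]%fset
             end].

Definition fin_cond P V L (x : fin_config X V) (z : fin_config X L) : R :=
  marginal P (concat x z) / marginal P z.

Lemma in_fsetD_notin V L (t : (L `\` V)%fset) : val t \notin V.
Proof. by have := valP t; rewrite in_fsetD => /andP[]. Qed.

Definition outer_restrict V L (xbar : outer_config X V) :
    fin_config X (L `\` V)%fset :=
  [ffun t => xbar (exist _ (val t) (in_fsetD_notin t))].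

Definition cond_seq P F V (xbar : outer_config X V) (x : fin_config X V) :
    R^nat :=
  fun n => fin_cond P x (outer_restrict (F n) xbar).

Definition limit_set P F V : set (outer_config X V) :=
  [set xbar | forall x : fin_config X V, cvgn (cond_seq P F xbar x)].

(* Meaningful for xbar in limit_set P F V only. *)
Definition cond_distr P F V (xbar : outer_config X V) (x : fin_config X V) :
    R :=
  limn (cond_seq P F xbar x).

Definition positive_cond_system P F : Prop :=
  forall V, V != fset0 -> forall xbar, limit_set P F xbar ->
  forall x : fin_config X V, 0 < cond_distr P F xbar x.

(* Meaningful when positive_cond_system P F and limit_set P F xbar hold. *)
Definition transition_energy P F V (xbar : outer_config X V)
    (x u : fin_config X V) : R :=
  ln (cond_distr P F xbar x / cond_distr P F xbar u).

End RandomField.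
Arguments limit_set {R d X hX} P F V _.

(* Main.v *)
Require Import Defs.
From mathcomp Require Import all_boot all_order all_algebra.
From mathcomp Require Import finmap.
From mathcomp Require Import all_classical all_reals all_analysis.
Import Order.TTheory GRing.Theory Num.Theory.
Import numFieldNormedType.Exports.
Local Open Scope classical_set_scope.
Local Open Scope ring_scope.

(* Summing P(xz) over x in X^V gives P(z), so every finite-conditional
   distribution sums to 1.  As X^V is finite, this passes to the limit along the
   windows: the g(alpha) sum to 1.  Since exp Delta(x, u) = g(x) / g(u), the
   Gibbs ratio is (g(x) / g(u)) / (1 / g(u)) = g(x). *)

Section Cylinders.
Set Implicit Arguments.
Unset Strict Implicit.
Context {R : realType} {d : nat} {X : finType} {hX : (1 < #|X|)%N}.
Implicit Types (P : random_field R d hX) (V S L : {fset lattice d}).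

(** The event behind [marginal P x], typed in the generated sigma-algebra so that measurability can
    be stated. *)
Definition cylinder S (x : fin_config X S) :
    set (g_sigma_algebraType (@coordinate_events d X hX)) :=
  [set w : config d hX | forall s : S, w (val s) = x s].
Arguments cylinder {S} x.

(** A finite intersection of generating coordinate events. *)
Lemma measurable_cylinder S (x : fin_config X S) : measurable (cylinder x).
Proof.
have -> : cylinder x = \bigcap_(s in [set: S])
    [set w : config d hX | w (val s) = x s].
  by apply/seteqP; split => w /= h s *; apply: h.
apply: fin_bigcap_measurable => // s _.
apply: sub_sigma_algebra; exists (val s) => //.
by exists [set x s] => //=; rewrite setTI.
Qed.

Lemma concatl V L (x : fin_config X V) (z : fin_config X L) t
    (tVL : t \in (V `|` L)%fset) (tV : t \in V) :
  concat x z [` tVL]%fset = x [` tV]%fset.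
Proof.
(* [concat] uses the membership proof supplied by [boolP]; proof irrelevance replaces it by the
   given one. *)
rewrite ffunE; destruct (boolP _) as [tV'|tV'].
  by rewrite (bool_irrelevance tV' tV).
by case: (negP tV').
Qed.

Lemma concatr V L (x : fin_config X V) (z : fin_config X L) t
    (tVL : t \in (V `|` L)%fset) (tL : t \in L) :
  t \notin V -> concat x z [` tVL]%fset = z [` tL]%fset.
Proof.
move=> tV; rewrite ffunE; destruct (boolP _) as [tV'|tV'].
  by case: (negP tV).
by rewrite (bool_irrelevance (in_concat_right tV') tL).
Qed.

Lemma cylinder_concat V L (x : fin_config X V) (z : fin_config X L) :
  [disjoint V & L]%fset -> cylinder (concat x z) = cylinder x `&` cylinder z.
Proof.
move=> VL; apply/seteqP; split => w /=.
- move=> h; split => -[t tS].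
  + have tVL : t \in (V `|` L)%fset by rewrite in_fsetU tS.
    by rewrite (h [` tVL]%fset) (concatl _ _ _ tS).
  + have tVL : t \in (V `|` L)%fset by rewrite in_fsetU tS orbT.
    rewrite (h [` tVL]%fset) (concatr _ _ _ tS)//.
    (* On an overlap [concat] would follow [x] and forget [z]; disjointness excludes this. *)
    by apply/negP => tV; move/fdisjointP: VL => /(_ _ tV); rewrite tS.
- move=> [hx hz] [t tVL]; have [tV|tV] := boolP (t \in V).
  + by rewrite (concatl _ _ _ tV) -hx.
  + have tL : t \in L by move: (tVL); rewrite in_fsetU (negbTE tV).
    by rewrite (concatr _ _ _ tL tV) -hz.
Qed.

(** As x runs over X^V, the cylinders of xz partition the cylinder of z, and P is additive. *)
Lemma sum_marginal_concat P V L (z : fin_config X L) :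
  [disjoint V & L]%fset ->
  \sum_(x : fin_config X V) marginal P (concat x z) = marginal P z.
Proof.
move=> VL; rewrite /marginal -/(cylinder z).
have -> : cylinder z =
    \bigcup_(x in [set: fin_config X V]) cylinder (concat x z).
  apply/seteqP; split => w /=.
  - move=> wz; exists [ffun s : V => w (val s)] => //.
    by rewrite cylinder_concat//; split => // s; rewrite ffunE.
  - by move=> [x _]; rewrite cylinder_concat// => -[].
have -> : [set: fin_config X V] = [set` index_enum (fin_config X V)].
  by apply/seteqP; split => x //= _; rewrite mem_index_enum.
rewrite measure_fin_bigcup.
- rewrite -fsbig_seq ?index_enum_uniq// sum_fine// => x _.
  by apply: fin_num_measure; exact: measurable_cylinder.
- exact: finite_seq.
(* A point common to two cylinders forces x = y, both being its restriction to V. *)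
- move=> x y _ _ [w [/=]]; rewrite !cylinder_concat// => -[wx _] [wy _].
  by apply/ffunP => s; rewrite -wx -wy.
- by move=> x _; exact: measurable_cylinder.
Qed.

Lemma disjoint_outer V L : [disjoint V & L `\` V]%fset.
Proof. by apply/fdisjointP => s sV; rewrite in_fsetD sV. Qed.

Lemma sum_fin_cond P V L (z : fin_config X L) :
  positive_field P -> V != fset0 -> [disjoint V & L]%fset ->
  \sum_(x : fin_config X V) fin_cond P x z = 1.
Proof.
move=> hP V0 VL; rewrite -mulr_suml sum_marginal_concat// divff//.
(* L may be empty, a case that [positive_field] does not cover; so P(z) is bounded below through
   marginals on the nonempty set V ∪ L. *)
rewrite -(sum_marginal_concat P z VL) gt_eqF//.
have VL0 : (V `|` L)%fset != fset0.
  by rewrite fsetU_eq0 negb_and V0.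
have x0 : fin_config X V by exact: [ffun=> enum_val (Ordinal (ltnW hX))].
rewrite (bigD1 x0)//= ltr_pwDl ?hP// sumr_ge0// => x _; exact/ltW/hP.
Qed.

Lemma sum_cond_distr P (F : filtration d) V (xbar : outer_config X V) :
  positive_field P -> V != fset0 -> limit_set P F V xbar ->
  \sum_(x : fin_config X V) cond_distr P F xbar x = 1.
Proof.
move=> hP V0 hx.
have h : \sum_(x : fin_config X V) cond_seq P F xbar x n @[n --> \oo] -->
         \sum_(x : fin_config X V) cond_distr P F xbar x.
  by apply: cvg_big => [|x _]; [exact: add_continuous | exact: hx].
apply/esym; rewrite -(cvg_lim _ h)//.
(* Every term is already 1, even for a window inside V, where conditioning is on the empty
   configuration. *)
rewrite (_ : (fun _ => _) = fun=> 1) ?lim_cst//.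
by apply/funext => n; apply: sum_fin_cond => //; exact: disjoint_outer.
Qed.

End Cylinders.

Theorem theorem2 (R : realType) (d : nat) (hd : (0 < d)%N)
  (X : finType) (hX : (1 < #|X|)%N)
  (P : random_field R d hX) (hP : positive_field P)
  (F : filtration d) (hG : positive_cond_system P F) :
  forall V : {fset lattice d}, V != fset0 ->
  forall xbar : outer_config X V, limit_set P F V xbar ->
  forall u x : fin_config X V,
    cond_distr P F xbar x =
    expR (transition_energy P F xbar x u) /
    \sum_(alpha : fin_config X V) expR (transition_energy P F xbar alpha u).
Proof.
move=> V V0 xbar hx u x.
have g_gt0 a : 0 < cond_distr P F xbar a by exact: hG.
have expE a : expR (transition_energy P F xbar a u) =
    cond_distr P F xbar a / cond_distr P F xbar u.
  (* Positivity of the system makes the ratio positive, so [expR] cancels [ln]. *)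
  by rewrite lnK// posrE divr_gt0.
under eq_bigr do rewrite expE.
rewrite expE -mulr_suml sum_cond_distr// mul1r invrK divfK//.
by rewrite gt_eqF.
Qed.
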